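(* Let $\{X(t):t\ge 0\}$ be a regular time-homogeneous semi-Markov process with finite state space $\mathcal S=\{1,\dots,k\}$ (so $k=|\mathcal S|$), embedded transition matrix $\bm P=[p_{ij}]$ and sojourn-time moment matrices $\bm N^{(r)}=[n_{ij}^{(r)}]$, $\bm N=\bm N^{(1)}$. Suppose that $j\in\mathcal S$ is universally accessible. Then the $r$-th moments of the first passage times from all states $i\in\mathcal S$ to state $j$, contained in the $k$-vector $$\bm M_j^{(r)}=\big[m_{ij}^{(r)}\big]_{i=1}^k,\qquad r\ge 1,$$ are solutions to the system of equations given by $$\bm M_j\equiv\bm M_j^{(1)}=\left[\bm I-\bm P+\bm P\bm e_j\bm e_j^T\right]^{-1}(\bm P\circ\bm N)\,\bm e,$$ and, if $r>1$, $$\bm M_j^{(r)}=\left[\bm I-\bm P+\bm P\bm e_j\bm e_j^T\right]^{-1}\Bigg[\big(\bm P\circ\bm N^{(r)}\big)\bm e+\sum_{s=1}^{r-1}\binom{r}{s}\Big[\big(\bm P\circ\bm N^{(r-s)}\big)\Big((\bm E-\bm I)_j\circ\bm M_j^{(s)}\Big)\Big]\Bigg],$$ where $\bm e$ is a column vector of ones and the scalar entries are the first passage moments $m_{ij}=m_{ij}^{(1)}$ and $m_{ij}^{(r)}$, $r\ge 2$, given by $$m_{ij}=\sum_{l=1}^k p_{il}\big[(1-\delta_{lj})m_{lj}+n_{il}\big],\qquad m_{ij}^{(r)}=\sum_{l=1}^k p_{il}n_{il}^{(r)}+\sum_{s=1}^{r}\binom{r}{s}\Big[\sum_{l\ne 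j}p_{il}\,n_{il}^{(r-s)}m_{lj}^{(s)}\Big].$$
   Context: Setting. $\{(X_n,T_n):n\ge 0\}$ is a Markov renewal process with finite state space $\mathcal S=\{1,\dots,k\}$ and time-homogeneous semi-Markov kernel $Q_{ij}(t)=\Pr(X_{n+1}=j,\ T_{n+1}-T_n\le t\mid X_n=i)$; $X_n$ is the state after the $n$-th transition and $T_n$ the time of the $n$-th transition. Put $p_{ij}=Q_{ij}(+\infty)=\Pr(X_{n+1}=j\mid X_n=i)$, $F_{ij}(t)=\Pr(T_{n+1}-T_n\le t\mid X_n=i,\ X_{n+1}=j)$, so that $Q_{ij}=p_{ij}F_{ij}$, and $n_{ij}^{(r)}=\int_0^\infty t^r\,dF_{ij}(t)$, $n_{ij}=n_{ij}^{(1)}$, $n_{ij}^{(0)}=1$. Standing assumption: $0<n_{ij}<\infty$ whenever $p_{ij}>0$. The semi-Markov process is $X(t)=X_n$ for $t\in[T_n,T_{n+1})$. Universal accessibility. Let $W_j(t)$ be the number of times during $(0,t]$ that the process transitions into state $j$, $\Psi_{ij}(t)=\Pr(W_j(t)>0\mid X(0)=i)$ and $\Psi_{ij}(+\infty)=\lim_{t\to\infty}\Psi_{ij}(t)$. State $j$ is universally accessible if $\Psi_{ij}(+\infty)=1$ for every $i\in\mathcal S$. First passage. $Y_j=\inf\{t\ge T_1:X(t)=j\}$, where $T_1>0$ is the time of the first transition (so $Y_j$ is the first passage time to $j$ from an initial state $i\ne j$, and the first return time if $i=j$); $G_{ij}(t)=\Pr(Y_j\le t\mid X(0)=i)$; and,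 if they exist, $m_{ij}^{(r)}=\int_0^\infty t^r\,dG_{ij}(t)=E[Y_j^r\mid X(0)=i]$, $r\ge 1$. Notation. $\bm I$ is the $k\times k$ identity matrix, $\bm E$ the $k\times k$ matrix of ones, $\bm e_j$ the $j$-th standard basis column vector of length $k$, $(\bm E-\bm I)_j$ the $j$-th column of $\bm E-\bm I$, $\circ$ the entrywise (Hadamard) product, and $\delta_{lj}$ equals $1$ if $l=j$ and $0$ otherwise. *)

(* Defs.v *)
From HB Require Import structures.
From mathcomp Require Import all_boot all_order all_algebra.
From mathcomp Require Import all_classical all_reals all_analysis.
Set Implicit Arguments.
Unset Strict Implicit.
Unset Printing Implicit Defensive.
Import Order.TTheory GRing.Theory Num.Theory.
Import numFieldNormedType.Exports.
Local Open Scope classical_set_scope.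
Local Open Scope ring_scope.

Section stieltjes_moment.
Context {R : realType}.
Implicit Type F : R -> R.

(* [lebesgue_stieltjes_measure] takes a bundled cumulative function;
   [cumul F] is [F] itself as soon as [F] is nondecreasing and
   right-continuous, which holds for every distribution function below
   (the other branch is never reached). *)
Definition cumul F : R -> R :=
  if `[< nondecreasing F /\ right_continuous F >] then F else cst 0.

Lemma cumul_nd F : nondecreasing (cumul F).
Proof.
rewrite /cumul; case: asboolP => [[ndF _] //|_].
by move=> x y _ /=.
Qed.

Lemma cumul_rc F : right_continuous (cumul F).
Proof.
rewrite /cumul; case: asboolP => [[_ rcF] //|_] x.
exact: cvg_cst.
Qed.

HB.instance Definition _ F :=
  isCumulative.Build R _ R (cumul F) (@cumul_nd F) (@cumul_rc F).

(* The integral of t ^ r with respect to dF over [0, +oo[ ; the domain includes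
   0, and a possible atom of dF there. *)
Definition stieltjes_moment F (r : nat) : \bar R :=
  \int[lebesgue_stieltjes_measure (cumul F)]_(t in `[0, +oo[) (t ^+ r)%:E.

End stieltjes_moment.

Section semi_markov_kernel.
Context {R : realType} {k : nat}.
Variable Q : 'I_k -> 'I_k -> R -> R.

Definition trans_prob (i j : 'I_k) : R := lim (Q i j t @[t --> +oo]).

(* When p_ij = 0 this is the zero function; every use of its moments below is
   multiplied by p_ij or restricted to p_ij > 0. *)
Definition sojourn_cdf (i j : 'I_k) (t : R) : R := Q i j t / trans_prob i j.

Definition sojourn_moment (r : nat) (i j : 'I_k) : \bar R :=
  stieltjes_moment (sojourn_cdf i j) r.

Definition trans_mx : 'M[R]_k := \matrix_(i, j) trans_prob i j.

Definition sojourn_moment_mx (r : nat) : 'M[R]_k :=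
  \matrix_(i, j) fine (sojourn_moment r i j).

End semi_markov_kernel.

Section markov_renewal.
Context {d : measure_display} {Omega : measurableType d} {R : realType}.
Context {k : nat}.
(* [P i] is the law Pr( . | X(0) = i). *)
Variable P : 'I_k -> probability Omega R.
Variables (X : nat -> Omega -> 'I_k) (T : nat -> Omega -> R).

(* The sigma-algebra generated by X_0, ..., X_n, T_0, ..., T_n. *)
Definition history (n : nat) : set (set Omega) :=
  <<s [set A | exists2 m, (m <= n)%N &
         (exists i, A = [set w | X m w = i]) \/
         (exists t, A = [set w | T m w <= t])] >>.

(* The last field says
     Pr(X_(n+1) = b, T_(n+1) - T_n <= t | X_0, ..., X_n, T_0, ..., T_n)
       = Q_{X_n b}(t)
   almost surely, integrated over the events of the past. *)
Record markov_renewal_process (Q : 'I_k -> 'I_k -> R -> R) : Prop := {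
  mrp_measurable_state : forall n i, measurable [set w | X n w = i] ;
  mrp_measurable_time : forall n, measurable_fun setT (T n) ;
  mrp_time0 : forall w, T 0 w = 0 ;
  mrp_time_nondecreasing : forall n w, T n w <= T n.+1 w ;
  mrp_initial_state : forall i, P i [set w | X 0 w = i] = 1%E ;
  mrp_time1_gt0 : forall i, P i [set w | 0 < T 1 w] = 1%E ;
  mrp_markov : forall (i : 'I_k) (n : nat) (A : set Omega) (a b : 'I_k) (t : R),
    history n A ->
    P i (A `&` [set w | X n w = a] `&`
         [set w | X n.+1 w = b /\ T n.+1 w - T n w <= t]) =
    (P i (A `&` [set w | X n w = a]) * (Q a b t)%:E)%E }.

Definition regular : Prop :=
  forall i, {ae P i, forall w, forall t : R, exists n, t < T n w}.

(* X(t) = X_n for the n such that T_n <= t < T_(n+1); it is unique since the T_n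
   are nondecreasing, and exists for all t >= 0 on almost every path by
   regularity. *)
Definition semi_markov (t : R) (w : Omega) : 'I_k :=
  X (xget 0%N [set n | T n w <= t < T n.+1 w]) w.

Definition num_visits (j : 'I_k) (t : R) (w : Omega) : \bar R :=
  counting [set n | 0 < T n w <= t /\ X n w = j].

Definition visit_prob (i j : 'I_k) (t : R) : R :=
  fine (P i [set w | (0 < num_visits j t w)%E]).

Definition universally_accessible (j : 'I_k) : Prop :=
  forall i, lim (visit_prob i j t @[t --> +oo]) = 1.

Definition passage_time (j : 'I_k) (w : Omega) : \bar R :=
  ereal_inf [set t%:E | t in [set t | T 1 w <= t /\ semi_markov t w = j]].

Definition passage_cdf (i j : 'I_k) (t : R) : R :=
  fine (P i [set w | (passage_time j w <= t%:E)%E]).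

Definition passage_moment (r : nat) (i j : 'I_k) : \bar R :=
  stieltjes_moment (passage_cdf i j) r.

Definition passage_moment_col (r : nat) (j : 'I_k) : 'cV[R]_k :=
  \col_i fine (passage_moment r i j).

End markov_renewal.

Section matrices.
Context {R : realType}.

Definition hadamard (m n : nat) (A B : 'M[R]_(m, n)) : 'M[R]_(m, n) :=
  map2_mx *%R A B.

Definition ones (m n : nat) : 'M[R]_(m, n) := const_mx 1.

Definition unit_col (k : nat) (j : 'I_k) : 'cV[R]_k := delta_mx j 0.

Definition passage_mx (k : nat) (P : 'M[R]_k) (j : 'I_k) : 'M[R]_k :=
  1%:M - P + P *m unit_col j *m (unit_col j)^T.

End matrices.
Arguments ones {R} m n.

(* Main.v *)
(* Write w_n^r(i,b) for the expectation of T_(n+1)^r on the event that X_1, ...,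
   X_n avoid j and X_(n+1) = b, under X_0 = i. By the Markov property, given the
   past and the states, the increment T_(n+2) - T_(n+1) is independent of
   T_(n+1), so w_(n+1)(i,b) is the sum over a <> j of the binomial convolutions
   of the moment sequences w_n(i,a) and w_0(a,b) = p_ab n_ab. Binomial
   convolution is associative, so this recursion on the last step turns into a
   recursion on the first step, without any shift of the process. On almost
   every path the passage time to j is T_(n+1) for the first n with
   X_(n+1) = j, so that m_ij^r is the sum over n of w_n^r(i,j): this yields the
   scalar equations in the extended reals.

   Universal accessibility says that the partial sums S_n of w_n^0(.,j) tend to
   1. If x <= A x, where A is the transition matrix with its j-th column
   replaced by 0, then x <= c (1 - S_n) for all n, hence x <= 0. This maximum
   principle makes I - A invertible, and (I - A)^(-1) b dominates the partial
   sums of the series for m^r, where b is the part of the right-hand side that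
   involves moments of lower order: this gives finiteness. *)

From HB Require Import structures.
Require Import Defs.
From mathcomp Require Import all_boot all_order all_algebra.
From mathcomp Require Import all_classical all_reals all_analysis.
From mathcomp Require Import measurable_realfun zify.
Import Order.TTheory GRing.Theory Num.Theory.
Import numFieldNormedType.Exports.
Set Implicit Arguments.
Unset Strict Implicit.
Unset Printing Implicit Defensive.
Local Open Scope classical_set_scope.
Local Open Scope ring_scope.

(** * Distribution functions and independence *)

Section measure_facts.
Local Open Scope ereal_scope.
Context d (T : measurableType d) (R : realType).

Lemma ge0_integral_mrestr (mu : {measure set T -> \bar R}) (D : set T)
    (mD : measurable D) (f : T -> \bar R) :
  measurable_fun setT f -> (forall x, 0 <= f x) ->
  \int[mrestr mu mD]_x f x = \int[mu]_(x in D) f x.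
Proof.
move=> mf f0; rewrite -(setUv D) ge0_integral_setU//; last 3 first.
- exact: measurableC.
- exact: measurable_funTS.
- by rewrite disj_set2E setICr.
rewrite (@eq_measure_integral _ _ _ D mu); last first.
  by move=> A mA AD; rewrite /= /mrestr setIidl.
rewrite (@eq_measure_integral _ _ _ (~` D) mzero); last first.
  by move=> A mA /disjoints_subset AD; rewrite /= /mrestr AD measure0.
by rewrite integral_measure_zero adde0.
Qed.

End measure_facts.

Section finite_measures_on_the_line.
Context (R : realType).
Implicit Types mu nu : {finite_measure set (measurableTypeR R) -> \bar R}.

Lemma finite_measure_cdf_nd mu :
  nondecreasing (fun t => fine (mu `]-oo, t]%classic)).
Proof.
move=> x y xy; rewrite fine_le ?fin_num_measure//.
by rewrite le_measure ?inE//; exact: subset_itvl.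
Qed.


(** By monotonicity it is enough to approach [a] along [a + 1/(n+1)]; the half-lines then decrease
    to []-oo, a]], and continuity from above applies. *)
Lemma finite_measure_cdf_rc mu :
  right_continuous (fun t => fine (mu `]-oo, t]%classic)).
Proof.
move=> a; apply/cvgrPdist_le => e e0.
have cF : fine (mu `]-oo, a + n.+1%:R^-1]%classic) @[n --> \oo] -->
    fine (mu `]-oo, a]%classic).
  apply: fine_cvg; rewrite fineK ?fin_num_measure// (itvNycEbigcap false).
  apply: (@nonincreasing_cvg_mu _ _ _ mu) => //.
  - by rewrite -ge0_fin_numE ?fin_num_measure.
  - exact: bigcap_measurable.
  - move=> m n mn; apply/subsetPset; apply: subset_itvl.
    by rewrite bnd_simp lerD2l lef_pV2 ?posrE// ler_nat.
have /cvgrPdist_le/(_ _ e0)[N _ /(_ N (leqnn _)) /= FN] := cF.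
near=> x; rewrite ler0_norm ?opprB; last first.
  by rewrite subr_le0; exact: finite_measure_cdf_nd.
rewrite (le_trans _ FN)// distrC (le_trans _ (ler_norm _))// lerD2r.
by apply: finite_measure_cdf_nd; near: x; apply: nbhs_right_le; rewrite ltrDl.
Unshelve. all: by end_near. Qed.

(** A Stieltjes measure is determined by its values on the intervals []a, b]]. Since [F] is
    nondecreasing and right-continuous, [cumul F] is [F], and both measures give [F b - F a].
    Stieltjes moments thereby become integrals against laws. *)
Lemma stieltjes_measureE mu (F : R -> R) :
  (forall t, F t = fine (mu `]-oo, t]%classic)) ->
  forall A : set (measurableTypeR R), measurable A ->
  lebesgue_stieltjes_measure (cumul F) A = mu A.
Proof.
move=> /funext -> A mA.
apply: lebesgue_stieltjes_measure_unique => // _ [[a b] _ <-] /=.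
rewrite /lebesgue_stieltjes_measure /measure_extension/=.
rewrite measurable_mu_extE/=; last exact: is_ocitv.
have [ab|ba] := leP a b; last first.
  by rewrite set_itv_ge ?wlength0 ?measure0// bnd_simp -leNgt ltW.
rewrite wlength_itv_bnd// /cumul; case: asboolP => [_|]; last first.
  by case; split; [exact: finite_measure_cdf_nd|exact: finite_measure_cdf_rc].
rewrite EFinB !fineK ?fin_num_measure//.
have -> : `]a, b]%classic = `]-oo, b] `\` `]-oo, a] :> set R.
  apply/seteqP; split => x /=; rewrite !in_itv/=.
    by move=> /andP[ax ->]; split => //; apply/negP; rewrite -ltNge.
  by move=> [-> /negP]; rewrite -ltNge andbT.
rewrite measureD ?setIidr//; first exact: subset_itvl.
by rewrite -ge0_fin_numE// fin_num_measure.
Qed.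

Lemma finite_measure_cdf_unique mu nu :
  (forall t, mu `]-oo, t]%classic = nu `]-oo, t]%classic) ->
  forall A : set (measurableTypeR R), measurable A -> mu A = nu A.
Proof.
move=> mn A mA; pose F t := fine (mu `]-oo, t]%classic).
rewrite -(@stieltjes_measureE mu F)// (@stieltjes_measureE nu F)//.
by move=> t; rewrite /F mn.
Qed.

Lemma stieltjes_momentE mu (F : R -> R) r :
  (forall t, F t = fine (mu `]-oo, t]%classic)) ->
  stieltjes_moment F r = (\int[mu]_(t in `[0%R, +oo[) (t ^+ r)%:E)%E.
Proof.
move=> muF; apply: eq_measure_integral => A mA _.
exact: stieltjes_measureE.
Qed.

End finite_measures_on_the_line.

Section law_on_event.
Local Open Scope ereal_scope.
Context d d' (T : measurableType d) (T' : measurableType d') (R : realType).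
Variables (mu : {finite_measure set T -> \bar R}) (D : set T).
Variables (mD : measurable D) (f : T -> T') (mf : measurable_fun setT f).

(** The image under [f] of [mu] restricted to [D], of total mass [mu D]. The two measurability
    proofs are arguments so that the measure structure can be attached to the term. *)
Definition law_on of measurable D & measurable_fun setT f : set T' -> \bar R :=
  fun B => mu (f @^-1` B `&` D).

Local Notation law := (law_on mD mf).

Let law0 : law set0 = 0.
Proof. by rewrite /law_on preimage_set0 set0I measure0. Qed.

Let law_ge0 B : 0 <= law B. Proof. exact: measure_ge0. Qed.

Let mpre B : measurable B -> measurable (f @^-1` B `&` D).
Proof.
by move=> mB; apply: measurableI => //; rewrite -[X in measurable X]setTI; exact: mf.
Qed.

Let law_sigma : semi_sigma_additive law.
Proof.
move=> F mF tF mU; rewrite /law_on preimage_bigcup setI_bigcupl.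
apply: measure_sigma_additive => [n|]; first exact: mpre.
apply/trivIsetP => i j _ _ ij; move/trivIsetP : tF => /(_ i j I I ij).
move=> FF0; rewrite setIACA (_ : f @^-1` F i `&` f @^-1` F j = set0) ?set0I//.
by rewrite -[RHS](preimage_set0 f) -FF0.
Qed.

HB.instance Definition _ := isMeasure.Build _ _ _ law law0 law_ge0 law_sigma.

Let law_fin : fin_num_fun law.
Proof. by move=> B mB; rewrite fin_num_measure//; exact: mpre. Qed.

HB.instance Definition _ := Measure_isFinite.Build _ _ _ law law_fin.

Lemma ge0_integral_law_on (g : T' -> \bar R) :
  measurable_fun setT g -> (forall x, 0 <= g x) ->
  \int[law]_x g x = \int[mu]_(x in D) g (f x).
Proof.
move=> mg g0.
rewrite -(@ge0_integral_mrestr _ _ _ mu _ mD (g \o f)); last 2 first.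
- exact: measurableT_comp.
- by move=> x; exact: g0.
by rewrite -[in RHS](preimage_setT f) -ge0_integral_pushforward.
Qed.

End law_on_event.

Section independence.
Local Open Scope ereal_scope.
Context d (T : measurableType d) (R : realType).
Variables (mu : {finite_measure set T -> \bar R}) (D E : set T) (U V : T -> R).
Variables (nu : {finite_measure set (measurableTypeR R) -> \bar R}).
Hypotheses (mD : measurable D) (mE : measurable E).
Hypotheses (mU : measurable_fun setT U) (mV : measurable_fun setT V).
Hypothesis indep : forall (B : set R) t, measurable B ->
  mu (U @^-1` B `&` D `&` (E `&` [set w | V w <= t]%R)) =
  mu (U @^-1` B `&` D) * nu `]-oo, t]%classic.

Let mpre (W : T -> R) B : measurable_fun setT W -> measurable B ->
  measurable (W @^-1` B).
Proof. by move=> mW mB; rewrite -[X in measurable X]setTI; exact: mW. Qed.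

(** For fixed [B] both sides are finite measures in [C]: a law of [V], and [nu] scaled by a
    constant. The hypothesis says that they agree on half-lines. *)
Let rect (B C : set R) : measurable B -> measurable C ->
  mu (U @^-1` B `&` D `&` (E `&` V @^-1` C)) = mu (U @^-1` B `&` D) * nu C.
Proof.
move=> mB mC; have mBD : measurable (U @^-1` B `&` D).
  by apply: measurableI => //; exact: mpre.
have mBDE : measurable (U @^-1` B `&` D `&` E) by exact: measurableI.
pose c := fine (mu (U @^-1` B `&` D)).
have c0 : (0 <= c)%R by exact: fine_ge0.
have cE : c%:E = mu (U @^-1` B `&` D) by rewrite fineK ?fin_num_measure.
have mV' : @measurable_fun _ _ T (measurableTypeR R) setT V := mV.
rewrite -cE setIA setIC.
apply: (@finite_measure_cdf_unique _ (law_on mu mBDE mV')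
  (mscale (NngNum c0) nu) _ C mC) => t.
transitivity (c%:E * nu `]-oo, t]%classic); last by [].
rewrite cE -indep//.
transitivity (mu (V @^-1` `]-oo, t] `&` (U @^-1` B `&` D `&` E))); first by [].
rewrite setIC -setIA; congr (mu (_ `&` (_ `&` _))).
Qed.

(** By [rect], the joint law of [(U, V)] on [D] and [E] is the product of the law of [U] on [D] with
    [nu]; Tonelli then separates the integrals. The event [E] is absorbed by [nu], which need not
    have mass 1. *)
Lemma ge0_integral_indep (f g : R -> \bar R) :
  measurable_fun setT f -> measurable_fun setT g ->
  (forall x, 0 <= f x) -> (forall x, 0 <= g x) ->
  \int[mu]_(w in D `&` E) (f (U w) * g (V w)) =
  \int[mu]_(w in D) f (U w) * \int[nu]_x g x.
Proof.
move=> mf mg f0 g0.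
have mDE : measurable (D `&` E) by exact: measurableI.
have mU' : @measurable_fun _ _ T (measurableTypeR R) setT U := mU.
have mV' : @measurable_fun _ _ T (measurableTypeR R) setT V := mV.
have mUV := measurable_fun_pair mU' mV'.
pose h (z : measurableTypeR R * measurableTypeR R) := f z.1 * g z.2.
have mh : measurable_fun setT h.
  by apply: emeasurable_funM; exact: measurableT_comp.
have h0 z : 0 <= h z by exact: mule_ge0.
transitivity (\int[law_on mu mDE mUV]_z h z).
  by rewrite ge0_integral_law_on.
pose m1 : {finite_measure set (measurableTypeR R) -> \bar R} := law_on mu mD mU'.
transitivity (\int[m1 \x nu]_z h z).
  apply: eq_measure_integral => A mA _; apply/esym.
  apply: product_measure_unique => // B C mB mC.
  rewrite /m1 /= /law_on -rect//; congr (mu _).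
  by apply/seteqP; split => x /=; tauto.
rewrite fubini_tonelli1//.
under eq_integral => x _.
  rewrite /fubini_F /h/= ge0_integralZl//.
  over.
rewrite /= -(@ge0_integral_law_on _ _ T (measurableTypeR R) R mu D mD U mU' f)//.
by rewrite ge0_integralZr//; apply: integral_ge0.
Qed.

End independence.

(** * The Markov property *)

Lemma probability_setI1 d (T : measurableType d) (R : realType)
    (P : probability T R) (D A : set T) :
  measurable D -> measurable A -> P D = 1%E -> P (D `&` A) = P A.
Proof.
move=> mD mA PD; have -> : P A = (P (A `\` D) + P (A `&` D))%E by exact: measureDI.
suff -> : P (A `\` D) = 0%E by rewrite add0e setIC.
apply/eqP; rewrite -measure_le0; apply: (@le_trans _ _ (P (~` D))).
  apply: le_measure; rewrite ?inE; [exact: measurableD|exact: measurableC|].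
  by move=> x [].
by rewrite probability_setC// PD subee.
Qed.

Section markov_renewal_facts.
Local Open Scope ereal_scope.
Context (d : measure_display) (Omega : measurableType d) (R : realType).
Context (k : nat) (P : 'I_k -> probability Omega R).
Context (X : nat -> Omega -> 'I_k) (T : nat -> Omega -> R).
Context (Q : 'I_k -> 'I_k -> R -> R).
Hypothesis mrp : markov_renewal_process P X T Q.

Let mX := mrp_measurable_state mrp.
Let mT := mrp_measurable_time mrp.
#[local] Hint Resolve mX mT : core.

Lemma renewal_time_ge0 n w : (0 <= T n w)%R.
Proof.
elim: n => [|n IH]; first by rewrite (mrp_time0 mrp).
by rewrite (le_trans IH)// (mrp_time_nondecreasing mrp).
Qed.

Lemma measurable_time_le n t : measurable [set w | T n w <= t]%R.
Proof.
rewrite (_ : [set w | _] = T n @^-1` `]-oo, t]%classic).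
  by rewrite -[X in measurable X]setTI; exact: mT.
by apply/seteqP; split => w /=; rewrite in_itv.
Qed.

Lemma history_measurable n A : history X T n A -> measurable A.
Proof.
move: A; apply: smallest_sub.
  exact: sigma_algebra_measurable.
by move=> A [m _ [[i ->]|[t ->]]]; [exact: mX|exact: measurable_time_le].
Qed.

Lemma historyI n A B : history X T n A -> history X T n B ->
  history X T n (A `&` B).
Proof. exact: (@measurableI _ (g_sigma_algebraType _)). Qed.

Lemma historyC n A : history X T n A -> history X T n (~` A).
Proof. exact: (@measurableC _ (g_sigma_algebraType _)). Qed.

Lemma historyT n : history X T n setT.
Proof. exact: (@measurableT _ (g_sigma_algebraType _)). Qed.

Lemma history_state m n i : (m <= n)%N -> history X T n [set w | X m w = i].
Proof. by move=> mn; apply: sub_sigma_algebra; exists m => //; left; exists i. Qed.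

(** The generators of the history contain only half-lines, whereas [rect] needs every Borel event of
    [T n] as an event of the past. *)
Lemma history_time n B : measurable B -> history X T n (T n @^-1` B).
Proof.
move=> mB.
pose H := [set A | exists2 m, (m <= n)%N &
  (exists i, A = [set w | X m w = i]) \/ (exists t, A = [set w | T m w <= t]%R)].
have : @measurable_fun _ _ (g_sigma_algebraType H) R setT (T n).
  apply: (@measurability _ _ (g_sigma_algebraType H) R setT (T n)
    (@RGenOInfty.G R) (@RGenOInfty.measurableE R)).
  move=> _ [_ [a ->] <-]; rewrite setTI.
  rewrite (_ : _ @^-1` _ = ~` [set w | T n w <= a]%R); last first.
    by apply/seteqP; split => w /=; rewrite in_itv/= andbT ltNge => /negP.
  apply: (@measurableC _ (g_sigma_algebraType H)).
  by apply: sub_sigma_algebra; exists n => //; right; exists a.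
by move=> /(_ measurableT _ mB); rewrite setTI.
Qed.

(** The Markov property at [n = 0] with the trivial past, since [X 0 = a] almost surely and
    [T 0 = 0]. Thus [Q a b] is the distribution function of [T 1] on the event [X 1 = b]. *)
Lemma semi_markov_kernelE a b t :
  (Q a b t)%:E = P a [set w | X 1%N w = b /\ (T 1%N w <= t)%R].
Proof.
have mA : measurable [set w | X 1%N w = b /\ (T 1%N w <= t)%R].
  exact: (measurableI _ _ (mX 1%N b) (measurable_time_le 1%N t)).
have := mrp_markov mrp a a b t (@historyT 0%N).
rewrite setTI (mrp_initial_state mrp) mul1e => <-.
rewrite -(probability_setI1 (mX 0%N a) mA (mrp_initial_state mrp a)).
congr (P a (_ `&` _)); apply/seteqP; split => w /=;
  by rewrite (mrp_time0 mrp) subr0.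
Qed.

(** The index starts at 1: the initial state is left free, so that for a start in [j] the first
    return is what gets counted. *)
Definition avoids j n := [set w | forall m, (0 < m <= n)%N -> X m w <> j].

Lemma history_avoids j m n : (m <= n)%N -> history X T n (avoids j m).
Proof.
move=> mn; rewrite (_ : avoids j m =
    \bigcap_(l in [set l | (0 < l <= m)%N]) ~` [set w | X l w = j]); last first.
  by apply/seteqP; split => w H l /H.
apply: (@bigcap_measurableType _ (g_sigma_algebraType _)).
move=> l /andP[_ lm]; apply: historyC; apply: history_state.
exact: leq_trans mn.
Qed.

(** Independence of [T n] and the next increment, with [nu] the law of [T 1] on [X 1 = b] under
    [P a]. *)
Lemma markov_integral i n A a b (f g : R -> \bar R) :
  history X T n A -> measurable_fun setT f -> measurable_fun setT g ->
  (forall x, 0 <= f x) -> (forall x, 0 <= g x) ->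
  \int[P i]_(w in A `&` [set w | X n w = a] `&` [set w | X n.+1 w = b])
     (f (T n w) * g (T n.+1 w - T n w)%R) =
  \int[P i]_(w in A `&` [set w | X n w = a]) f (T n w) *
  \int[P a]_(w in [set w | X 1%N w = b]) g (T 1%N w).
Proof.
move=> hA mf mg f0 g0.
have mT1 : @measurable_fun _ _ Omega (measurableTypeR R) setT (T 1%N) := mT 1%N.
rewrite -(@ge0_integral_law_on _ _ Omega (measurableTypeR R) R (P a) _ (mX 1%N b)
  _ mT1 g)//.
have mtau : measurable_fun setT (fun w => T n.+1 w - T n w)%R.
  exact: measurable_funB.
apply: (ge0_integral_indep (U := T n) (V := fun w => T n.+1 w - T n w)%R) => //.
  by apply: measurableI => //; exact: history_measurable hA.
move=> B t mB; rewrite (setIA _ A).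
have hBA := historyI (@history_time n _ mB) hA.
apply: (etrans (mrp_markov mrp i a b t hBA)); rewrite semi_markov_kernelE.
congr (_ * P a _); apply/seteqP; split => w /=; rewrite in_itv/=; tauto.
Qed.

End markov_renewal_facts.

(** * Moments of the first hit *)

(* Convolution of moment sequences: if U and V are independent then the moments
   of U + V are [bconv] of those of U and V. *)
Definition bconv (R : realType) (x y : nat -> \bar R) (r : nat) : \bar R :=
  (\sum_(s < r.+1) 'C(r, s)%:R%:E * (x (r - s)%N * y s))%E.

Section first_hits.
Local Open Scope ereal_scope.
Context (d : measure_display) (Omega : measurableType d) (R : realType).
Context (k : nat) (P : 'I_k -> probability Omega R).
Context (X : nat -> Omega -> 'I_k) (T : nat -> Omega -> R).
Context (Q : 'I_k -> 'I_k -> R -> R).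
Hypothesis mrp : markov_renewal_process P X T Q.

Let mX := mrp_measurable_state mrp.
Let mT := mrp_measurable_time mrp.
#[local] Hint Resolve mX mT : core.

(** For [b = j] this is a first entry into [j] at transition [n + 1]; the other values of [b] are
    needed by the recursion on the last step. *)
Definition first_hit j n b := avoids X j n `&` [set w | X n.+1 w = b].

Lemma measurable_first_hit j n b : measurable (first_hit j n b).
Proof.
by apply: measurableI => //; exact: (history_measurable mrp (@history_avoids _ _ _ _ X T j n n (leqnn n))).
Qed.

Lemma measurable_time_exp n r : measurable_fun setT (fun w => (T n w ^+ r)%:E).
Proof. by apply/measurable_EFinP; exact: measurable_funX. Qed.

Definition hit_moment j n r i b :=
  \int[P i]_(w in first_hit j n b) (T n.+1 w ^+ r)%:E.

Definition step_moment r i b :=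
  \int[P i]_(w in [set w | X 1%N w = b]) (T 1%N w ^+ r)%:E.

Lemma hit_moment_ge0 j n r i b : 0 <= hit_moment j n r i b.
Proof.
by apply: integral_ge0 => w _; rewrite lee_fin exprn_ge0// (renewal_time_ge0 mrp).
Qed.

Lemma step_moment_ge0 r i b : 0 <= step_moment r i b.
Proof.
by apply: integral_ge0 => w _; rewrite lee_fin exprn_ge0// (renewal_time_ge0 mrp).
Qed.

Lemma first_hit0 j b : first_hit j 0 b = [set w | X 1%N w = b].
Proof.
apply/seteqP; split => w; first by move=> [].
by split => // m /andP[m0]; rewrite leqNgt m0.
Qed.

Lemma hit_moment0 j r i b : hit_moment j 0 r i b = step_moment r i b.
Proof. by rewrite /hit_moment first_hit0. Qed.

Lemma markov_moment i n A a b r :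
  history X T n A ->
  \int[P i]_(w in A `&` [set w | X n w = a] `&` [set w | X n.+1 w = b])
     (T n.+1 w ^+ r)%:E =
  bconv (fun s => \int[P i]_(w in A `&` [set w | X n w = a]) (T n w ^+ s)%:E)
        (fun s => step_moment s a b) r.
Proof.
move=> hA; set D := _ `&` _ `&` _.
have mAa : measurable (A `&` [set w | X n w = a]).
  by apply: measurableI => //; exact: (history_measurable mrp hA).
have mD : measurable D by exact: measurableI.
(* The absolute value makes the integrand nonnegative on the whole line; it changes nothing at times
   and increments, which are nonnegative. *)
pose f s (x : R) := (`|x| ^+ s)%:E.
have mf s : measurable_fun setT (f s).
  by apply/measurable_EFinP/measurable_funX; exact: normr_measurable.
have f0 s x : 0 <= f s x by rewrite lee_fin exprn_ge0.
pose tau w := (T n.+1 w - T n w)%R.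
have mtau : measurable_fun setT tau by exact: measurable_funB.
have fT m s w : f s (T m w) = (T m w ^+ s)%:E.
  by rewrite /f ger0_norm// (renewal_time_ge0 mrp).
have ftau s w : f s (tau w) = (tau w ^+ s)%:E.
  by rewrite /f ger0_norm// /tau subr_ge0 (mrp_time_nondecreasing mrp).
transitivity (\int[P i]_(w in D) \sum_(s < r.+1)
    ('C(r, s)%:R%:E * (f (r - s)%N (T n w) * f s (tau w)))).
  apply: eq_integral => w _.
  rewrite (_ : T n.+1 w = T n w + tau w)%R; last by rewrite /tau addrC subrK.
  rewrite exprDn -sumEFin; apply: eq_bigr => s _.
  by rewrite fT ftau -!EFinM -mulr_natl.
have mff s : measurable_fun D (fun w => f (r - s)%N (T n w) * f s (tau w)).
  by apply: measurable_funTS; apply: emeasurable_funM; exact: measurableT_comp.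
rewrite ge0_integral_sum//=; last 2 first.
- by move=> s; exact: measurable_funeM.
- by move=> s w _; rewrite !mule_ge0.
apply: eq_bigr => s _; rewrite ge0_integralZl//; last first.
  by move=> w _; rewrite mule_ge0.
congr (_ * _).
rewrite (markov_integral mrp i a b hA (mf _) (mf _) (f0 _) (f0 _)).
congr (_ * _); apply: eq_integral => w _; by rewrite fT.
Qed.

(** The event splits according to the state [a] after transition [n + 1], which differs from [j];
    [markov_moment] applies to each piece. *)
Lemma hit_moment_forward j n r i b :
  hit_moment j n.+1 r i b =
  \sum_(a < k | a != j)
     bconv (fun s => hit_moment j n s i a) (fun s => step_moment s a b) r.
Proof.
pose F (a : 'I_k) := avoids X j n `&` [set w | X n.+1 w = a] `&`
  [set w | X n.+2 w = b].
have mF a : measurable (F a).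
  by apply: measurableI => //; exact: measurable_first_hit.
have E : first_hit j n.+1 b = \big[setU/set0]_(a <- enum [pred a | a != j]) F a.
  rewrite -bigcup_seq; apply/seteqP; split => w.
    move=> [av Xb]; exists (X n.+1 w).
      by rewrite /= mem_enum inE; apply/eqP; apply: av; rewrite /= leqnn.
    by split => //; split => // m /andP[m0 mn]; apply: av; rewrite m0 (leqW mn).
  move=> [a /=]; rewrite mem_enum inE => aj [[av Xa] Xb]; split => // m /andP[m0].
  rewrite leq_eqVlt => /orP[/eqP->|mn]; last by apply: av; rewrite m0.
  by rewrite Xa; exact/eqP.
rewrite /hit_moment E ge0_integral_bigsetU//=; last 4 first.
- exact: enum_uniq.
- apply/trivIsetP => a a' _ _ aa'; apply/seteqP; split => // w [[[_ Xa] _] [[_ Xa'] _]].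
  by move/eqP : aa'; apply; rewrite -Xa -Xa'.
- by apply: measurable_funTS; exact: measurable_time_exp.
- by move=> w _; rewrite lee_fin exprn_ge0// (renewal_time_ge0 mrp).
rewrite big_enum/=; apply: eq_bigr => a aj.
exact: (markov_moment i a b r (@history_avoids _ _ _ _ X T j n n.+1 (leqnSn n))).
Qed.

End first_hits.

(** * Associativity of binomial convolution *)

Lemma bin_trinomial r v t : (t + v <= r)%N ->
  ('C(r, t + v) * 'C(t + v, v) = 'C(r, v) * 'C(r - v, t))%N.
Proof.
move=> tvr; have vr : (v <= r)%N by rewrite (leq_trans _ tvr)// leq_addl.
have trv : (t <= r - v)%N by rewrite leq_subRL// addnC.
(* Multiplied by this product of factorials, both sides become [r!]. *)
have F0 : (0 < v`! * t`! * (r - (t + v))`!)%N by rewrite !muln_gt0 !fact_gt0.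
apply/eqP; rewrite -(eqn_pmul2r F0); apply/eqP.
have E1 := bin_fact tvr; have E2 := bin_fact vr; have E3 := bin_fact trv.
have := bin_fact (leq_addl t v); rewrite addnK => E4.
transitivity r`!.
  by rewrite -E1 -E4; lia.
by rewrite -E2 -E3 -subnDA (addnC v t); lia.
Qed.

Section binomial_convolution.
Local Open Scope ereal_scope.
Context (R : realType).
Implicit Types x y z : nat -> \bar R.

Lemma bconv_ge0 x y r : (forall s, 0 <= x s) -> (forall s, 0 <= y s) ->
  0 <= bconv x y r.
Proof. by move=> x0 y0; apply: sume_ge0 => s _; rewrite !mule_ge0// lee_fin. Qed.

Lemma eq_bconv x x' y y' r : (forall s, (s <= r)%N -> x s = x' s) ->
  (forall s, (s <= r)%N -> y s = y' s) -> bconv x y r = bconv x' y' r.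
Proof.
move=> xx yy; apply: eq_bigr => -[s /=]; rewrite ltnS => sr _.
by rewrite xx ?leq_subr// yy.
Qed.

Lemma bconv_suml (I : finType) (A : pred I) (x : I -> nat -> \bar R) y r :
  (forall i s, 0 <= x i s) -> (forall s, 0 <= y s) ->
  bconv (fun s => \sum_(i | A i) x i s) y r = \sum_(i | A i) bconv (x i) y r.
Proof.
move=> x0 y0; rewrite /bconv exchange_big/=; apply: eq_bigr => s _.
rewrite ge0_sume_distrl// ge0_sume_distrr// => i _.
by rewrite mule_ge0.
Qed.

Lemma bconv_sumr (I : finType) (A : pred I) x (y : I -> nat -> \bar R) r :
  (forall s, 0 <= x s) -> (forall i s, 0 <= y i s) ->
  bconv x (fun s => \sum_(i | A i) y i s) r = \sum_(i | A i) bconv x (y i) r.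
Proof.
move=> x0 y0; rewrite /bconv exchange_big/=; apply: eq_bigr => s _.
rewrite ge0_sume_distrr// ge0_sume_distrr// => i _.
by rewrite mule_ge0.
Qed.

Lemma bconvA x y z r :
  (forall s, 0 <= x s) -> (forall s, 0 <= y s) -> (forall s, 0 <= z s) ->
  bconv (bconv x y) z r = bconv x (bconv y z) r.
Proof.
move=> x0 y0 z0.
(* The trinomial term with orders [r - u], [u - v], [v]. The left side runs over [v] and [t] with
   [u = t + v], the right side over [v <= u <= r]; the two triangles are matched by exchanging the
   sums and shifting the index by [v]. *)
pose F u v := ('C(r, u) * 'C(u, v))%N%:R%:E * (x (r - u)%N * (y (u - v)%N * z v)).
transitivity (\sum_(v < r.+1) \sum_(t < (r - v).+1) F (t + v)%N v).
  apply: eq_bigr => -[v /=]; rewrite ltnS => vr _.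
  rewrite ge0_sume_distrl; last by move=> t _; rewrite !mule_ge0// lee_fin.
  rewrite ge0_sume_distrr; last by move=> t _; rewrite !mule_ge0// lee_fin.
  apply: eq_bigr => -[t /=]; rewrite ltnS => trv _.
  rewrite /F bin_trinomial; last by rewrite addnC -leq_subRL.
  rewrite addnK natrM EFinM -subnDA (addnC v t) -!muleA.
  by [].
transitivity (\sum_(u < r.+1) \sum_(v < u.+1) F u v); last first.
  apply: eq_bigr => u _.
  rewrite ge0_sume_distrr; last by move=> t _; rewrite !mule_ge0// lee_fin.
  rewrite ge0_sume_distrr; last by move=> t _; rewrite !mule_ge0// lee_fin.
  apply: eq_bigr => v _; rewrite /F natrM EFinM -!muleA; congr (_ * _).
  by rewrite [RHS]muleCA.
transitivity (\sum_(u < r.+1) \sum_(v < r.+1 | (v <= u)%N) F u v); last first.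
  apply: eq_bigr => u _; rewrite (big_ord_widen_cond r.+1 predT)//.
rewrite [RHS](exchange_big_dep predT)//=; apply: eq_bigr => -[v /=].
rewrite ltnS => vr _.
rewrite -(big_mkord (fun i => (v <= i)%N) (fun i => F i v)).
rewrite -(big_nat_widenl _ _ _ predT)// -subSn// -(big_mkord predT (fun t => F (t + v)%N v)).
rewrite -[in RHS](add0n v).
by rewrite (big_addn 0 r.+1 v predT (fun u => F u v)).
Qed.

End binomial_convolution.

Section nneseries_facts.
Local Open Scope ereal_scope.
Context (R : realType).

Lemma ge0_nneseriesZl (f : nat -> \bar R) c : 0 <= c -> (forall n, 0 <= f n) ->
  \sum_(n <oo) c * f n = c * \sum_(n <oo) f n.
Proof.
case: c => [c||//] c0 f0; first by rewrite nneseriesZl.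
(* Here [c] is [+oo]: either every term is 0 and [+oo * 0 = 0] on both sides, or one positive term
   makes both sides infinite. *)
have [f00|/existsNP[n /eqP fn0]] := pselect (forall n, f n = 0).
  by rewrite !eseries0 ?mule0// => n _ _; rewrite f00 ?mule0.
have fn : 0 < f n by rewrite lt0e fn0/=.
have S0 : 0 < \sum_(n <oo) f n.
  apply: (lt_le_trans fn).
  rewrite (le_trans _ (@nneseries_lim_ge _ f predT 0 n.+1 _))//.
  by rewrite big_nat_recr//= leeDr// sume_ge0.
rewrite gt0_mulye//.
rewrite (eseries_pinfty _ (isT : predT n))//.
- by move=> m _; rewrite gt_eqF// (lt_le_trans _ (mule_ge0 _ (f0 m))).
- by rewrite gt0_mulye.
Qed.

End nneseries_facts.

(** * First-step equations for the partial sums and the series of hit moments *)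

Section first_step_decomposition.
Local Open Scope ereal_scope.
Context (d : measure_display) (Omega : measurableType d) (R : realType).
Context (k : nat) (P : 'I_k -> probability Omega R).
Context (X : nat -> Omega -> 'I_k) (T : nat -> Omega -> R).
Context (Q : 'I_k -> 'I_k -> R -> R).
Hypothesis mrp : markov_renewal_process P X T Q.

Let h := hit_moment P X T.
Let q := step_moment P X T.
Let h0 := hit_moment_ge0 mrp.
Let q0 := step_moment_ge0 mrp.

(** Induction on [n]: the last step is split off, the induction hypothesis splits off the first step
    of the rest, and [bconvA] regroups the middle and last factors into a forward recursion started
    at [c]. *)
Lemma hit_moment_backward j n r i b :
  h j n.+1 r i b = \sum_(a < k | a != j) bconv (q ^~ i ^~ a) (h j n ^~ a ^~ b) r.
Proof.
elim: n r i b => [|n IH] r i b; rewrite [LHS](hit_moment_forward mrp).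
  by apply: eq_bigr => a _; apply: eq_bconv => s _; rewrite /h hit_moment0.
transitivity (\sum_(a < k | a != j) \sum_(c < k | c != j)
    bconv (bconv (q ^~ i ^~ c) (h j n ^~ c ^~ a)) (q ^~ a ^~ b) r).
  apply: eq_bigr => a _; rewrite -bconv_suml//; last first.
    by move=> c s; exact: bconv_ge0.
  by apply: eq_bconv => s _ //; exact: IH.
rewrite exchange_big/=; apply: eq_bigr => c _.
transitivity (\sum_(a < k | a != j)
    bconv (q ^~ i ^~ c) (bconv (h j n ^~ c ^~ a) (q ^~ a ^~ b)) r).
  by apply: eq_bigr => a _; rewrite bconvA.
rewrite -bconv_sumr//; last first.
  by move=> a s; exact: bconv_ge0.
by apply: eq_bconv => s _ //; rewrite [RHS](hit_moment_forward mrp).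
Qed.

Definition partial_passage_moment j n r i := \sum_(m < n) h j m r i j.

Definition passage_series j r i := \sum_(n <oo) h j n r i j.

Let S := partial_passage_moment.
Let M := passage_series.

Lemma partial_passage_momentS j n r i :
  S j n.+1 r i =
  q r i j + \sum_(a < k | a != j) bconv (q ^~ i ^~ a) (S j n ^~ a) r.
Proof.
rewrite /S /partial_passage_moment big_ord_recl; congr (_ + _); first exact: hit_moment0.
under eq_bigr do rewrite hit_moment_backward.
rewrite exchange_big/=; apply: eq_bigr => a _.
by rewrite bconv_sumr.
Qed.

(** All terms are nonnegative, so the series commutes with the finite sums and with the factors even
    when the values are infinite. *)
Lemma passage_seriesE j r i :
  M j r i = q r i j + \sum_(a < k | a != j) bconv (q ^~ i ^~ a) (M j ^~ a) r.
Proof.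
rewrite /M /passage_series nneseries_recl//.
rewrite -(nneseries_addn 1)//; congr (_ + _); first exact: hit_moment0.
transitivity (\sum_(n <oo) \sum_(a < k | a != j)
    bconv (q ^~ i ^~ a) (h j n ^~ a ^~ j) r).
  by apply: eq_eseriesr => n _; rewrite addn1 hit_moment_backward.
rewrite nneseries_sum; last first.
  by move=> a n _; apply: bconv_ge0.
apply: eq_bigr => a _; rewrite nneseries_sum; last first.
  by move=> s n _; rewrite !mule_ge0// lee_fin.
apply: eq_bigr => s _; rewrite nneseriesZl; last first.
  by move=> n _; rewrite mule_ge0.
by rewrite ge0_nneseriesZl.
Qed.

End first_step_decomposition.

(** * Sample paths *)

Lemma probability_ae_eq d (T : measurableType d) (R : realType)
    (P : probability T R) (A B : set T) :
  measurable A -> measurable B -> {ae P, forall w, A w <-> B w} -> P A = P B.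
Proof.
move=> mA mB [N [mN N0 ABN]].
have mNC : measurable (~` N) by exact: measurableC.
have NC1 : P (~` N) = 1%E by rewrite probability_setC// N0 sube0.
rewrite -(probability_setI1 mNC mA NC1) -(probability_setI1 mNC mB NC1).
congr (P _); apply/seteqP; split => w [Nw ABw]; split => //;
  have /contrapT[AB BA] : ~ ~ (A w <-> B w) by [move=> nAB; apply: Nw; exact: ABN|auto].
- exact: AB.
- exact: BA.
Qed.

Lemma probability_cvg_bigcup d (T : measurableType d) (R : realType)
    (P : probability T R) (A : R -> set T) (B : set T) :
  (forall t, measurable (A t)) -> {homo A : s t / s <= t >-> s `<=` t} ->
  \bigcup_t A t = B ->
  fine (P (A t)) @[t --> +oo] --> fine (P B).
Proof.
move=> mA ndA AB.
(* Integer times suffice by monotonicity, which reduces the limit to continuity from below. *)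
have UA : \bigcup_(n : nat) A n%:R = B.
  rewrite -AB; apply/seteqP; split => w [t _ Atw]; first by exists t%:R.
  by exists (Num.truncn t).+1 => //; apply: (ndA t) => //; rewrite ltW// truncnS_gt.
have mB : measurable B by rewrite -UA; exact: bigcupT_measurable.
have cA : fine (P (A n%:R)) @[n --> \oo] --> fine (P B).
  apply: fine_cvg; rewrite fineK ?fin_num_measure// -UA.
  apply: (@nondecreasing_cvg_mu _ _ _ P) => //; first by rewrite UA.
  by move=> m n mn; apply/subsetPset; apply: ndA; rewrite ler_nat.
apply/cvgrPdist_le => e e0.
have /cvgrPdist_le/(_ _ e0)[N _ /(_ N (leqnn _)) /= FN] := cA.
near=> t; have Nt : N%:R <= t by near: t; exact: nbhs_pinfty_ge.
have AtB : (P (A t) <= P B)%E by rewrite le_measure ?inE// -AB; exact: bigcup_sup.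
rewrite ger0_norm ?subr_ge0 ?fine_le ?fin_num_measure//.
rewrite (le_trans _ FN)// (le_trans _ (ler_norm _))// lerD2l lerN2.
by rewrite fine_le ?fin_num_measure// le_measure ?inE//; exact: ndA.
Unshelve. all: by end_near. Qed.

Section passage_paths.
Context (d : measure_display) (Omega : measurableType d) (R : realType).
Context (k : nat).
Context (X : nat -> Omega -> 'I_k) (T : nat -> Omega -> R).
Variables (j : 'I_k) (w : Omega).
Hypothesis ndT : forall n, T n w <= T n.+1 w.

Let leT m n : (m <= n)%N -> T m w <= T n w.
Proof.
move=> /subnK <-; elim: (n - m)%N => //= i IH.
by rewrite (le_trans IH)// addSn.
Qed.

Let lt_time m n : T m w < T n w -> (m < n)%N.
Proof. by move=> mn; rewrite ltnNge; apply/negP => /leT; rewrite leNgt mn. Qed.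

Lemma semi_markov_at s n : T n w <= s < T n.+1 w -> semi_markov X T s w = X n w.
Proof.
move=> sn; rewrite /semi_markov (@xget_unique _ 0%N _ n)// => m /= /andP[ms sm].
case/andP: sn => ns sn.
apply/eqP; rewrite eqn_leq; apply/andP; split; rewrite -ltnS; apply: lt_time.
  exact: le_lt_trans sn.
exact: le_lt_trans sm.
Qed.

Lemma semi_markov_outside s : (forall n, T n w <= s) -> semi_markov X T s w = X 0 w.
Proof.
move=> Ts; rewrite /semi_markov xgetPN// => m /= /andP[_].
by rewrite ltNge Ts.
Qed.

(* [semi_markov] falls back on [X 0] after an explosion of the jump times. *)
Lemma passage_time_leP t : (passage_time X T j w <= t%:E)%E <->
  (exists n, [/\ T n.+1 w <= t, T n.+1 w < T n.+2 w & X n.+1 w = j]) \/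
  (X 0 w = j /\ forall n, T n w <= t).
Proof.
rewrite /passage_time; set S := [set _ | _]; split; last first.
  move=> H; suff [s St st] : exists2 s, S s & s <= t.
    by rewrite (le_trans _ (_ : s%:E <= t%:E)%E)// ereal_inf_lbound//; exists s.
  case: H => [[n [nt nn Xj]]|[X0 Tt]].
    exists (T n.+1 w) => //; split; first exact: leT.
    by rewrite (@semi_markov_at _ n.+1)// lexx.
  by exists t => //; split; [exact: Tt|rewrite semi_markov_outside].
move=> inft; apply: contrapT => /not_orP[nA nB].
(* If both alternatives fail, a lower bound of [S] above [t] will contradict this. *)
have lb t' : (forall s, S s -> t' <= s) -> t' <= t.
  move=> H; rewrite -lee_fin; apply: le_trans inft.
  by apply: le_ereal_inf_tmp => _ [s Ss <-]; rewrite lee_fin; exact: H.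
have Scase s : S s ->
    (exists n, [/\ T n.+1 w <= s, t < T n.+1 w & X n.+1 w = j]) \/
    (X 0 w = j /\ forall n, T n w <= s).
  move=> [T1s Ssj].
  have [[n /andP[ns sn]]|nn] := pselect (exists n, T n w <= s < T n.+1 w).
    left; case: n ns sn => [|n] ns sn; first by move: sn; rewrite ltNge T1s.
    have Xj : X n.+1 w = j by rewrite -Ssj (@semi_markov_at _ n.+1)// ns.
    exists n; split => //; rewrite ltNge; apply/negP => nt; apply: nA.
    by exists n; split => //; exact: le_lt_trans sn.
  have Ts n : T n w <= s.
    elim: n => [|n IH]; first by rewrite (le_trans _ T1s).
    by rewrite leNgt; apply/negP => sn; apply: nn; exists n; rewrite IH.
  by right; split => //; rewrite -Ssj semi_markov_outside.
(* If all jump times stay below [t], then [S] is empty and [t + 1] is a lower bound. Otherwise the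
   first jump time after [t] is one. *)
have [Tt|/existsNP[n0 /negP]] := pselect (forall n, T n w <= t).
  have := lb (t + 1); rewrite gerDl ler10 => H; suff : false by [].
  apply: H => s /Scase[[n [_ + _]]|[X0 _]]; first by rewrite ltNge Tt.
  by case: nB.
rewrite -ltNge => tn0.
have [N tN minN] := @ex_minnP (fun n => t < T n w) (ex_intro _ n0 tn0).
suff : T N w <= t by rewrite leNgt tN.
apply: lb => s /Scase[[n [ns tn _]]|[_ Ts]]; last exact: Ts.
by rewrite (le_trans _ ns)//; apply: leT; exact: minN.
Qed.

Lemma num_visits_gt0P t : (0 < num_visits X T j t w)%E <->
  exists n, 0 < T n w <= t /\ X n w = j.
Proof.
rewrite /num_visits; set A := [set n | _]; split.
  move=> A0; apply: contrapT => nA; suff A_0 : A = set0.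
    by move: A0; rewrite A_0 measure0 ltxx.
  by apply/seteqP; split => // n An; apply: nA; exists n.
move=> [n An]; apply: (@lt_le_trans _ _ (counting [set n] : \bar R)).
  by rewrite /counting asboolT; [rewrite fset_set1 finmap.cardfs1 lte_fin|exact: finite_set1].
by rewrite le_measure ?inE// => _ ->.
Qed.

End passage_paths.

Section passage_law.
Context (d : measure_display) (Omega : measurableType d) (R : realType).
Context (k : nat) (P : 'I_k -> probability Omega R).
Context (X : nat -> Omega -> 'I_k) (T : nat -> Omega -> R).
Context (Q : 'I_k -> 'I_k -> R -> R).
Hypothesis mrp : markov_renewal_process P X T Q.

Let mX := mrp_measurable_state mrp.
Let mT := mrp_measurable_time mrp.
Let mTle := measurable_time_le mrp.
#[local] Hint Resolve mX mT mTle : core.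

Lemma renewal_time_nd w m n : (m <= n)%N -> T m w <= T n w.
Proof.
move=> /subnK <-; elim: (n - m)%N => //= i IH.
by rewrite (le_trans IH)// addSn (mrp_time_nondecreasing mrp).
Qed.

Lemma semi_markov_kernel0 a b : Q a b 0 = 0.
Proof.
apply: EFin_inj; rewrite (semi_markov_kernelE mrp).
have m1 : measurable [set w | 0 < T 1%N w].
  rewrite (_ : [set w | _] = ~` [set w | T 1%N w <= 0]).
    exact: measurableC.
  by apply/seteqP; split => w /=; rewrite ltNge => /negP.
have m2 : measurable [set w | X 1%N w = b /\ T 1%N w <= 0].
  exact: (measurableI _ _ (mX 1%N b) (mTle 1%N 0)).
rewrite -(probability_setI1 m1 m2 (mrp_time1_gt0 mrp a)).
rewrite (_ : _ `&` _ = set0) ?measure0//.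
by apply/seteqP; split => // w /= [+ [_]]; rewrite leNgt => ->.
Qed.

Lemma measurable_increment_le n t : measurable [set w | T n.+1 w - T n w <= t].
Proof.
rewrite (_ : [set w | _] = (T n.+1 \- T n) @^-1` `]-oo, t]%classic).
  rewrite -[X in measurable X]setTI.
  by apply: (measurable_funB (mT n.+1) (mT n)).
by apply/seteqP; split => w /=; rewrite in_itv.
Qed.

(** Since [T 1 > 0] almost surely, the kernel vanishes at 0. The Markov property carries this to
    every increment, over finitely many pairs of states and countably many [n]. *)
Lemma time_increasing_ae i : {ae P i, forall w, forall n, T n w < T n.+1 w}.
Proof.
apply/ae_foralln => n.
have : {ae P i, forall w, forall a b : 'I_k,
    ~ [/\ X n w = a, X n.+1 w = b & T n.+1 w - T n w <= 0]}.
  apply: filter_forall => a; apply: filter_forall => b.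
  pose E := [set w | X n w = a] `&`
    [set w | X n.+1 w = b /\ T n.+1 w - T n w <= 0].
  exists E; split.
  - apply: measurableI => //; apply: (measurableI _ _ (mX n.+1 b)).
    exact: measurable_increment_le.
  - have := mrp_markov mrp i a b 0 (@historyT _ _ _ _ X T n).
    by rewrite setTI semi_markov_kernel0 mule0.
  - by move=> w /= /contrapT[].
apply: filterS => w H; rewrite ltNge; apply/negP => nT.
by apply: (H (X n w) (X n.+1 w)); split => //; rewrite subr_le0.
Qed.

(** The common form to which [visit_prob] and [passage_cdf] are both reduced; the shifted index
    excludes the initial position. *)
Definition hit_by j t := [set w | exists n, T n.+1 w <= t /\ X n.+1 w = j].

Lemma hit_by_first j t :
  hit_by j t = \bigcup_n (first_hit X j n j `&` [set w | T n.+1 w <= t]).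
Proof.
apply/seteqP; split => w; last by move=> [n _ [[_ Xj] Tt]]; exists n.
move=> [n [Tt Xj]].
have exX : exists m, X m.+1 w == j by exists n; apply/eqP.
have [m /eqP Xm minm] := ex_minnP exX.
exists m => //; split.
  split => // -[|l]//= lm Xl.
  by have := minm l; rewrite Xl eqxx leqNgt lm => /(_ isT).
by rewrite /= (le_trans _ Tt)// renewal_time_nd// ltnS minm//; apply/eqP.
Qed.

Lemma measurable_first_hit_by j n t :
  measurable (first_hit X j n j `&` [set w | T n.+1 w <= t]).
Proof. by apply: measurableI => //; exact: (measurable_first_hit mrp). Qed.

Lemma measurable_hit_by j t : measurable (hit_by j t).
Proof.
rewrite hit_by_first; apply: bigcupT_measurable => n.
exact: measurable_first_hit_by.
Qed.

Lemma trivIset_first_hit j : trivIset setT (fun n => first_hit X j n j).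
Proof.
apply/trivIsetP => m n _ _; wlog mn : m n / (m < n)%N.
  move=> H mn; move: (mn); rewrite neq_ltn => /orP[mn'|nm]; first exact: H.
  by rewrite setIC; apply: H => //; rewrite eq_sym.
move=> _; apply/seteqP; split => // w [[_ Xm] [av _]].
by apply: (av m.+1) => //; rewrite mn.
Qed.

Lemma num_visitsE i j t :
  P i [set w | (0 < num_visits X T j t w)%E] = P i (hit_by j t).
Proof.
apply: probability_ae_eq; last 1 first.
- move: (time_increasing_ae i); apply: filterS => w ltT.
  rewrite /= num_visits_gt0P; split => [[[|n] [/andP[T0 Tt] Xj]]|[n [Tt Xj]]].
  + by move: T0; rewrite (mrp_time0 mrp) ltxx.
  + by exists n.
  + by exists n.+1; rewrite Tt (le_lt_trans _ (ltT n))// (renewal_time_ge0 mrp).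
- rewrite (_ : [set w | _] = \bigcup_n
    ((~` [set w | T n w <= 0] `&` [set w | T n w <= t]) `&` [set w | X n w = j])).
    apply: bigcupT_measurable => n; apply: measurableI => //.
    by apply: measurableI => //; exact: measurableC.
  apply/seteqP; split => w /=.
    move=> /num_visits_gt0P[n [/andP[T0 Tt] Xj]]; exists n => //=.
    by split => //; split => //; apply/negP; rewrite -ltNge.
  move=> [n _ [[/= /negP T0 Tt] Xj]]; apply/num_visits_gt0P.
  by exists n; rewrite ltNge T0.
- exact: measurable_hit_by.
Qed.

Hypothesis regT : regular P T.

(** Outside a null set the jump times increase strictly, so each visited state is really occupied,
    and by regularity they are unbounded, which rules out the fallback value of [semi_markov]. *)
Lemma passage_timeE i j t :
  P i [set w | (passage_time X T j w <= t%:E)%E] = P i (hit_by j t).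
Proof.
have ndT := mrp_time_nondecreasing mrp.
apply: probability_ae_eq; last 1 first.
- move: (regT i) (time_increasing_ae i); apply: filterS2 => w ooT ltT.
  rewrite /= passage_time_leP//; split => [[[n [nt _ Xj]]|[_ Tt]]|[n [nt Xj]]].
  + by exists n.
  + by have [n] := ooT t; rewrite ltNge Tt.
  + by left; exists n; split.
- rewrite (_ : [set w | _] = (\bigcup_n
      (([set w | T n.+1 w <= t] `&` ~` [set w | T n.+2 w - T n.+1 w <= 0]) `&`
       [set w | X n.+1 w = j])) `|`
      ([set w | X 0 w = j] `&` \bigcap_n [set w | T n w <= t])).
    apply: measurableU; last first.
      by apply: measurableI => //; exact: bigcapT_measurable.
    apply: bigcupT_measurable => n; apply: measurableI => //.
    apply: measurableI => //; apply: measurableC.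
    exact: measurable_increment_le.
  apply/seteqP; split => w /=.
    move=> /(passage_time_leP _ _ (ndT^~ w))[[n [nt ltT Xj]]|[X0 Tt]].
      left; exists n => //; split => //=; split => //; apply/negP.
      by rewrite -ltNge subr_gt0.
    by right; split => // n _; exact: Tt.
  move=> [[n _ [/= [nt /negP ltT] Xj]]|[/= X0 Tt]];
    apply/(passage_time_leP _ _ (ndT^~ w)).
    by left; exists n; split => //; rewrite -subr_gt0 ltNge.
  by right; split => // n; exact: Tt.
- exact: measurable_hit_by.
Qed.

End passage_law.

(** * Moments of the passage time *)

Section moments.
Local Open Scope ereal_scope.
Context (d : measure_display) (Omega : measurableType d) (R : realType).

Lemma measurable_moment_fun (D : set R) r : measurable_fun D (fun t => (t ^+ r)%:E).
Proof. by apply/measurable_EFinP; exact: measurable_funX. Qed.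

Lemma moment_law_on (mu : {finite_measure set Omega -> \bar R}) D
    (mD : measurable D) (U : Omega -> R)
    (mU : @measurable_fun _ _ Omega (measurableTypeR R) setT U) r :
  (forall w, 0 <= U w)%R ->
  \int[law_on mu mD mU]_(t in `[0%R, +oo[) (t ^+ r)%:E =
  \int[mu]_(w in D) (U w ^+ r)%:E.
Proof.
move=> U0; rewrite integral_mkcond ge0_integral_law_on.
- apply: eq_integral => w _; rewrite patchE mem_set//=.
  by rewrite in_itv/= U0.
- apply/(measurable_restrictT _ _).1 => //; exact: measurable_moment_fun.
- move=> t; rewrite patchE; case: ifPn => //; rewrite inE/= in_itv/= andbT => t0.
  by rewrite lee_fin exprn_ge0.
Qed.

Context (k : nat) (P : 'I_k -> probability Omega R).
Context (X : nat -> Omega -> 'I_k) (T : nat -> Omega -> R).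
Context (Q : 'I_k -> 'I_k -> R -> R).
Hypothesis mrp : markov_renewal_process P X T Q.

Let mX := mrp_measurable_state mrp.
Let mT : forall n, @measurable_fun _ _ Omega (measurableTypeR R) setT (T n) :=
  mrp_measurable_time mrp.
Let mTle := measurable_time_le mrp.
#[local] Hint Resolve mX mT mTle : core.

Lemma trans_probE a b : (trans_prob Q a b)%:E = P a [set w | X 1%N w = b].
Proof.
rewrite -[RHS]fineK ?fin_num_measure//; congr (_%:E); apply/cvg_lim => //.
have -> : Q a b = fun t => fine (P a [set w | X 1%N w = b /\ (T 1%N w <= t)%R]).
  by apply/funext => t; rewrite -(semi_markov_kernelE mrp).
apply: probability_cvg_bigcup.
- by move=> t; apply: (measurableI _ _ (mX 1%N b) (mTle 1%N t)).
- by move=> s t st w /= [-> /le_trans]; split => //; auto.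
- apply/seteqP; split => w; first by move=> [t _ []].
  by move=> Xb; exists (T 1%N w).
Qed.

Lemma step_moment_zero a b : step_moment P X T 0 a b = (trans_prob Q a b)%:E.
Proof.
rewrite /step_moment trans_probE; under eq_integral do rewrite expr0.
by rewrite integral_cst// mul1e.
Qed.

(** The factor [p_ab] turns the conditional sojourn law into the law of [T 1] on the event
    [X 1 = b]. *)
Lemma sojourn_momentE r a b :
  (trans_prob Q a b)%:E * sojourn_moment Q r a b = step_moment P X T r a b.
Proof.
set p := trans_prob Q a b.
have p0 : (0 <= p)%R by rewrite -lee_fin trans_probE.
have pV0 : (0 <= p^-1)%R by rewrite invr_ge0.
(* For [p = 0] the convention [0^-1 = 0] makes [mu] the zero measure, in agreement with
   [sojourn_cdf]. *)
pose mu : {finite_measure set (measurableTypeR R) -> \bar R} :=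
  mscale (NngNum pV0) (law_on (P a) (mX 1%N b) (mT 1%N)).
have -> : sojourn_moment Q r a b = p^-1%:E * step_moment P X T r a b.
  rewrite /sojourn_moment (@stieltjes_momentE _ mu).
    rewrite ge0_integral_mscale//=.
    - by rewrite moment_law_on// => w; exact: (renewal_time_ge0 mrp).
    - exact: measurable_moment_fun.
    - by move=> t; rewrite /= in_itv/= andbT => t0; rewrite lee_fin exprn_ge0.
  move=> t; rewrite /mu /= /mscale/= /law_on.
  rewrite (_ : _ `&` _ = [set w | X 1%N w = b /\ (T 1%N w <= t)%R]); last first.
    by apply/seteqP; split => w /=; rewrite in_itv/= => -[].
  by rewrite -(semi_markov_kernelE mrp) -EFinM/= mulrC.
have [p_eq0|p_neq0] := eqVneq p 0%R; last first.
  by rewrite muleA -EFinM divff// mul1e.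
rewrite p_eq0 mul0e /step_moment null_set_integral//.
- by apply: measurable_funTS; exact: (measurable_time_exp mrp).
- by have := trans_probE a b; rewrite -/p p_eq0 => /esym.
Qed.

Hypothesis regT : regular P T.

(** Order 0 adds up the probabilities of the disjoint first hits, that is, the probability of ever
    entering [j], which is the limit of [visit_prob]. *)
Lemma passage_series_zero i j : universally_accessible P X T j ->
  passage_series P X T j 0 i = 1.
Proof.
move=> /(_ i) acc.
have mh n : measurable (first_hit X j n j) by exact: (measurable_first_hit mrp).
transitivity (P i (\bigcup_n first_hit X j n j)).
  rewrite measure_semi_bigcup//; last 2 first.
  - exact: trivIset_first_hit.
  - exact: bigcupT_measurable.
  apply: eq_eseriesr => n _; rewrite /hit_moment.
  under eq_integral do rewrite expr0.
  by rewrite integral_cst// mul1e.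
rewrite -[LHS]fineK ?fin_num_measure//; last exact: bigcupT_measurable.
congr (_%:E); rewrite -acc; apply/esym/cvg_lim => //.
have -> : visit_prob P X T i j = fun t => fine (P i (hit_by X T j t)).
  by apply/funext => t; rewrite /visit_prob (num_visitsE mrp).
apply: probability_cvg_bigcup.
- by move=> t; exact: (measurable_hit_by mrp).
- by move=> s t st w [n [Ts Xj]]; exists n; split => //; exact: le_trans st.
- apply/seteqP; split => w; last by move=> [n _ [_ Xj]]; exists (T n.+1 w) => //; exists n.
  move=> [t _]; rewrite (hit_by_first mrp) => -[n _ [hn _]].
  by exists n.
Qed.

(** The law of the passage time is the sum over [n] of the laws of [T n.+1] on the disjoint
    first-hit events, and integration against a sum of measures is the sum of the integrals. *)
Lemma passage_momentE r i j :
  passage_moment P X T r i j = passage_series P X T j r i.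
Proof.
have mh n : measurable (first_hit X j n j) by exact: (measurable_first_hit mrp).
pose law n : {measure set (measurableTypeR R) -> \bar R} :=
  law_on (P i) (mh n) (mT n.+1).
have lawE A : measurable A -> mseries law 0 A =
    P i (\bigcup_n (first_hit X j n j `&` T n.+1 @^-1` A)).
  move=> mA.
  have mhA n : measurable (first_hit X j n j `&` T n.+1 @^-1` A).
    apply: measurableI => //.
    by rewrite -[X in measurable X]setTI; exact: mT.
  rewrite measure_semi_bigcup//; last exact: bigcupT_measurable.
  - by apply: eq_eseriesr => n _; rewrite /law /= /law_on setIC.
  - apply/trivIsetP => m n _ _ mn.
    have /trivIsetP/(_ m n I I mn) E := @trivIset_first_hit _ _ _ X j.
    by rewrite setIACA E set0I.
have law_oo : mseries law 0 setT < +oo.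
  rewrite lawE// -ge0_fin_numE ?fin_num_measure//.
  apply: bigcupT_measurable => n; rewrite preimage_setT setIT//.
(* Restricting to the whole line only equips the sum of the laws with its finiteness. *)
pose mu : {finite_measure set (measurableTypeR R) -> \bar R} :=
  mfrestr measurableT law_oo.
rewrite /passage_moment (@stieltjes_momentE _ mu); last first.
  move=> t; rewrite /passage_cdf (passage_timeE mrp regT).
  rewrite /mu /= /mfrestr /mrestr setIT lawE// (hit_by_first mrp).
  by [].
transitivity (\int[mseries law 0]_(t in `[0%R, +oo[) (t ^+ r)%:E).
  by apply: eq_measure_integral => A mA _; rewrite /mu /= /mfrestr /mrestr setIT.
rewrite ge0_integral_measure_series//.
- apply: eq_eseriesr => n _; rewrite moment_law_on// => w.
  exact: (renewal_time_ge0 mrp).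
- by move=> t; rewrite /= in_itv/= andbT => t0; rewrite lee_fin exprn_ge0.
- exact: measurable_moment_fun.
Qed.

End moments.

(** * The linear system *)

Section moment_system.
Context (R : realType) (k : nat) (j : 'I_k).

(** The matrix is [I - A] with [A] the taboo matrix: adding [P e_j e_j^T] cancels column [j] of
    [P]. *)
Lemma passage_mxE (p : 'M[R]_k) i l :
  passage_mx p j i l = (i == l)%:R - (l != j)%:R * p i l.
Proof.
rewrite /passage_mx !mxE big_ord1 !mxE eqxx andbT.
rewrite (bigD1 j)//= !mxE !eqxx mulr1 big1 ?addr0; last first.
  by move=> a aj; rewrite !mxE (negbTE aj) mulr0.
by case: (eqVneq l j) => [->|_] /=; rewrite ?mulr1 ?mulr0 ?mul0r ?mul1r ?addr0 ?subr0 ?addrNK.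
Qed.

Lemma passage_mx_mulE (p : 'M[R]_k) (x : 'cV[R]_k) i :
  (passage_mx p j *m x) i 0 = x i 0 - \sum_(l < k | l != j) p i l * x l 0.
Proof.
rewrite mxE; under eq_bigr do rewrite passage_mxE mulrBl.
rewrite big_split/= (bigD1 i)//= eqxx mul1r big1 ?addr0; last first.
  by move=> l li; rewrite eq_sym (negbTE li) mul0r.
congr (_ + _); rewrite [in RHS]big_mkcond/= -sumrN; apply: eq_bigr => l _.
by case: ifPn => lj; rewrite ?mul1r// !mul0r.
Qed.

Variable p : 'M[R]_k.
Variable S : nat -> 'I_k -> R.
Hypothesis p0 : forall i l, 0 <= p i l.
Hypothesis p1 : forall i, p i j + \sum_(l < k | l != j) p i l = 1.
Hypothesis S0 : forall i, S 0 i = 0.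
Hypothesis SS : forall n i, S n.+1 i = p i j + \sum_(l < k | l != j) p i l * S n l.
Hypothesis S1 : forall i, S n i @[n --> \oo] --> (1 : R).

Lemma taboo_max_principle (x : 'I_k -> R) :
  (forall i, x i <= \sum_(l < k | l != j) p i l * x l) -> forall i, x i <= 0.
Proof.
move=> xA i; pose c := \sum_(l < k) `|x l|.
have xc l : x l <= c.
  by rewrite (le_trans (ler_norm _))// /c (bigD1 l)//= lerDl sumr_ge0.
(* As the rows of [p] sum to 1, the defect [1 - S n] obeys the homogeneous recursion given by [A],
   so the bound passes from [n] to [n + 1]. *)
have xS n : forall i, x i <= c * (1 - S n i).
  elim: n => [|n IH] l; first by rewrite S0 subr0 mulr1.
  rewrite (le_trans (xA l))//.
  apply: (@le_trans _ _ (\sum_(a < k | a != j) p l a * (c * (1 - S n a)))).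
    by apply: ler_sum => a _; rewrite ler_wpM2l.
  rewrite SS -{2}(p1 l) opprD addrACA subrr add0r -sumrB mulr_sumr.
  by apply: ler_sum => a _; rewrite mulrCA mulrBr mulr1.
have cS : c * (1 - S n i) @[n --> \oo] --> (0 : R).
  rewrite -(mulr0 c) -(subrr (1 : R)); apply: cvgMr.
  by apply: cvgB => //; exact: cvg_cst.
by rewrite -(cvg_lim _ cS)//; apply: limr_ge; [apply/cvg_ex; exists 0|exact: nearW].
Qed.

(** A kernel vector satisfies [v = A v], so the maximum principle applies to [v] and to [- v]. The
    transpose appears because [kermx] is a left kernel. *)
Lemma passage_mx_unit : passage_mx p j \in unitmx.
Proof.
rewrite -unitmx_tr -row_free_unit -kermx_eq0; apply/eqP/row_matrixP => a.
rewrite row0; set v := row a _.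
have : v *m (passage_mx p j)^T = 0.
  by apply: sub_kermxP; rewrite /v row_sub.
move=> /(congr1 trmx); rewrite trmx_mul trmxK trmx0 => v0.
have xA i : v^T i 0 = \sum_(l < k | l != j) p i l * v^T l 0.
  by apply/eqP; rewrite -subr_eq0 -passage_mx_mulE v0 mxE.
apply/rowP => i; rewrite [RHS]mxE; apply/eqP; rewrite eq_le.
have -> : v 0 i = v^T i 0 by rewrite [RHS]mxE.
rewrite (@taboo_max_principle (fun i => v^T i 0))/=; last by move=> l; rewrite -xA.
rewrite -oppr_le0 (@taboo_max_principle (fun i => - v^T i 0))// => l.
by rewrite xA -sumrN; apply: ler_sum => b _; rewrite mulrN.
Qed.

(** The solution comes from the inverse; its sign comes from the maximum principle for [- y],
    because [b >= 0]. *)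
Lemma passage_system_sol (b : 'cV[R]_k) : (forall i, 0 <= b i 0) ->
  exists y : 'I_k -> R, (forall i, 0 <= y i) /\
    forall i, y i = b i 0 + \sum_(l < k | l != j) p i l * y l.
Proof.
move=> b0; pose y i := (invmx (passage_mx p j) *m b) i 0.
have yE i : y i = b i 0 + \sum_(l < k | l != j) p i l * y l.
  apply/eqP; rewrite -subr_eq; apply/eqP.
  rewrite -(passage_mx_mulE p (invmx (passage_mx p j) *m b)) mulmxA mulmxV ?mul1mx//.
  exact: passage_mx_unit.
exists y; split => // i; rewrite -oppr_le0.
apply: (@taboo_max_principle (fun i => - y i)) => l.
rewrite {1}yE opprD -sumrN.
under [leRHS]eq_bigr do rewrite mulrN.
by rewrite gerDr oppr_le0.
Qed.

End moment_system.

(** Infinite [x] is covered because [fine] sends both infinities to 0. *)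
Lemma fineZl (R : realType) (c : R) (x : \bar R) : fine (c%:E * x) = c * fine x.
Proof.
case: (ltgtP c 0) => [c0|c0|->]; last by rewrite mul0e mul0r.
  by case: x => [x||] //=; rewrite ?lt0_muley ?lt0_muleNy ?lte_fin// mulr0.
by case: x => [x||] //=; rewrite ?gt0_muley ?gt0_muleNy ?lte_fin// mulr0.
Qed.

(** * Passage moments: scalar recursion, finiteness and matrix form *)

Section passage_moments.
Local Open Scope ereal_scope.
Context (d : measure_display) (Omega : measurableType d) (R : realType).
Context (k : nat) (Pr : 'I_k -> probability Omega R).
Context (X : nat -> Omega -> 'I_k) (T : nat -> Omega -> R).
Context (Q : 'I_k -> 'I_k -> R -> R) (j : 'I_k).
Hypothesis mrp : markov_renewal_process Pr X T Q.
Hypothesis regT : regular Pr T.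
Hypothesis acc : universally_accessible Pr X T j.

Let p := trans_prob Q.
Let q := step_moment Pr X T.
Let m r i := passage_moment Pr X T r i j.
Let q0 r a b : 0 <= q r a b := step_moment_ge0 mrp r a b.

Let m0 r i : 0 <= m r i.
Proof.
rewrite /m (passage_momentE mrp regT).
by apply: nneseries_ge0 => n _ _; exact: (hit_moment_ge0 mrp).
Qed.

Lemma passage_moment_eq r i : m r i =
  q r i j + \sum_(l < k | l != j) bconv (q ^~ i ^~ l) (m ^~ l) r.
Proof.
rewrite /m (passage_momentE mrp regT) (passage_seriesE mrp); congr (_ + _).
apply: eq_bigr => l _; apply: eq_bconv => s _ //.
by rewrite (passage_momentE mrp regT).
Qed.

Lemma passage_moment_zero i : m 0 i = 1.
Proof.
by rewrite /m (passage_momentE mrp regT) (passage_series_zero mrp i acc).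
Qed.

(** As [m 0 = 1], the term of index 0 in each convolution is [q r i l]; together with [q r i j]
    these fill the sum over all [l]. *)
Lemma passage_moment_rec r i : m r i =
  \sum_(l < k) q r i l + \sum_(1 <= s < r.+1) ('C(r, s))%:R%:E *
    (\sum_(l < k | l != j) q (r - s)%N i l * m s l).
Proof.
rewrite passage_moment_eq [X in _ = X + _](bigD1 j)//= -[RHS]addeA; congr (_ + _).
transitivity (\sum_(l < k | l != j) (q r i l +
    \sum_(1 <= s < r.+1) ('C(r, s))%:R%:E * (q (r - s)%N i l * m s l))).
  apply: eq_bigr => l _; rewrite /bconv big_ord_recl/= bin0 mul1e subn0.
  rewrite passage_moment_zero mule1; congr (_ + _).
  by rewrite big_add1 /= big_mkord.
rewrite big_split/=; congr (_ + _); rewrite exchange_big/=.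
apply: eq_bigr => s _; rewrite ge0_sume_distrr// => l _.
by rewrite mule_ge0.
Qed.

Lemma trans_prob_ge0 a b : (0 <= p a b)%R.
Proof. by rewrite -lee_fin (trans_probE mrp). Qed.

(** This is the moment equation of order 0. *)
Lemma trans_prob_sum i : (p i j + \sum_(l < k | l != j) p i l = 1)%R.
Proof.
apply: EFin_inj; rewrite -(passage_moment_zero i) passage_moment_eq.
rewrite EFinD -sumEFin /q (step_moment_zero mrp); congr (_ + _).
apply: eq_bigr => l _; rewrite /bconv big_ord1 bin0 mul1e passage_moment_zero.
by rewrite mule1 /q (step_moment_zero mrp).
Qed.

Let S n r i := partial_passage_moment Pr X T j n r i.

Let S_le n r i : S n r i <= m r i.
Proof.
rewrite /m (passage_momentE mrp regT) /S /partial_passage_moment.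
rewrite -(big_mkord predT (fun n => hit_moment Pr X T j n r i j)).
by apply: nneseries_lim_ge => l _ _; exact: (hit_moment_ge0 mrp).
Qed.

Let S_ge0 n r i : 0 <= S n r i.
Proof. by apply: sume_ge0 => l _; exact: (hit_moment_ge0 mrp). Qed.

Let S_cvg r i : S n r i @[n --> \oo] --> m r i.
Proof.
rewrite /m (passage_momentE mrp regT) /passage_series /S.
have -> : (fun n => partial_passage_moment Pr X T j n r i) =
    (fun n => \sum_(0 <= l < n) hit_moment Pr X T j l r i j).
  by apply/funext => n; rewrite big_mkord.
by apply: is_cvg_nneseries => n _ _; exact: (hit_moment_ge0 mrp).
Qed.

Let S0_fin n i : S n 0 i \is a fin_num.
Proof.
by rewrite ge0_fin_numE// (le_lt_trans (S_le n 0 i))// passage_moment_zero ltry.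
Qed.

(** The probability of entering [j] within [n] transitions: the sequence to which the linear-system
    results are applied. *)
Let s n i := fine (S n 0 i).

Let s0 i : s 0 i = 0%R.
Proof. by rewrite /s /S /partial_passage_moment big_ord0. Qed.

Let sS n i : (s n.+1 i = p i j + \sum_(l < k | l != j) p i l * s n l)%R.
Proof.
apply: EFin_inj; rewrite /s fineK// /S (partial_passage_momentS mrp).
rewrite EFinD -sumEFin (step_moment_zero mrp); congr (_ + _).
apply: eq_bigr => l _; rewrite /bconv big_ord1 bin0 mul1e.
by rewrite (step_moment_zero mrp) EFinM fineK.
Qed.

Let s1 i : s n i @[n --> \oo] --> (1 : R)%R.
Proof. by apply: fine_cvg; rewrite -(passage_moment_zero i); exact: S_cvg. Qed.

Let P := trans_mx Q.

Let PE i l : P i l = p i l. Proof. by rewrite mxE. Qed.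

Lemma trans_mx_passage_unit : passage_mx P j \in unitmx.
Proof.
apply: (@passage_mx_unit R k j P s) => //.
- by move=> i l; rewrite PE trans_prob_ge0.
- by move=> i; rewrite PE -[RHS](trans_prob_sum i); congr (_ + _)%R; apply: eq_bigr => l _; rewrite PE.
- by move=> n i; rewrite PE sS; congr (_ + _)%R; apply: eq_bigr => l _; rewrite PE.
Qed.


Lemma step_moment_le r u i l : (u <= r)%N -> q r i l < +oo -> q u i l < +oo.
Proof.
(* Comes from [t^u <= 1 + t^r] for [t >= 0], by comparing [t] with 1. *)
move=> ur qr; apply: (@le_lt_trans _ _ (q 0 i l + q r i l)); last first.
  by rewrite lte_add_pinfty// /q (step_moment_zero mrp) ltry.
have mE : measurable [set w | X 1%N w = l] := mrp_measurable_state mrp 1%N l.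
have mT v : measurable_fun [set w | X 1%N w = l] (fun w => (T 1%N w ^+ v)%:E).
  by apply: measurable_funTS; exact: (measurable_time_exp mrp).
have T0 v w : 0 <= (T 1%N w ^+ v)%:E.
  by rewrite lee_fin exprn_ge0// (renewal_time_ge0 mrp).
rewrite /q /step_moment -ge0_integralD//.
apply: ge0_le_integral => //.
- exact: emeasurable_funD.
- move=> w _; rewrite -EFinD lee_fin expr0.
  have t0 := renewal_time_ge0 mrp 1%N w.
  have [t1|/ltW t1] := leP (T 1%N w) 1%R.
    by rewrite (le_trans (exprn_ile1 u t0 t1))// lerDl exprn_ge0.
  by rewrite (le_trans (ler_weXn2l t1 ur))// lerDr.
Qed.

Lemma passage_moment_lty r : (forall i l, q r i l < +oo) -> forall i, m r i < +oo.
Proof.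
elim/ltn_ind: r => r IH qr.
have qu u i l : (u <= r)%N -> q u i l < +oo by move=> /step_moment_le; apply.
have mu u i : (u < r)%N -> m u i < +oo.
  by move=> ur; apply: IH => // a b; apply: qu; exact: ltnW.
pose F i l := \sum_(u < r) 'C(r, u)%:R%:E * (q (r - u)%N i l * m u l).
have F0 i l : 0 <= F i l by apply: sume_ge0 => u _; rewrite !mule_ge0// lee_fin.
have Foo i l : F i l < +oo.
  apply: lte_sum_pinfty => u _; apply: lte_mul_pinfty => //.
  apply: lte_mul_pinfty => //; last exact: mu.
  by rewrite ge0_fin_numE// qu// leq_subr.
(* The terms with passage moments of order below [r], finite by the strong induction; [y] will solve
   [y = B + A y]. *)
pose B i := q r i j + \sum_(l < k | l != j) F i l.
have B0 i : 0 <= B i by rewrite adde_ge0// sume_ge0.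
have Bfin i : B i \is a fin_num.
  by rewrite ge0_fin_numE// lte_add_pinfty// lte_sum_pinfty.
have := @passage_system_sol R k j P s _ _ s0 _ s1 (\col_i fine (B i)).
case=> [i l|i|n i|i|y [y0 yE]].
- by rewrite PE trans_prob_ge0.
- by rewrite PE -[RHS](trans_prob_sum i); congr (_ + _)%R; apply: eq_bigr => l _; rewrite PE.
- by rewrite PE sS; congr (_ + _)%R; apply: eq_bigr => l _; rewrite PE.
- by rewrite mxE fine_ge0.
have Sy n i : S n r i <= (y i)%:E.
  elim: n i => [|n IHn] i.
    by rewrite /S /partial_passage_moment big_ord0 lee_fin.
  rewrite yE mxE EFinD fineK// /S (partial_passage_momentS mrp) /B -[leRHS]addeA.
  rewrite leeD2l// -sumEFin -big_split/=; apply: lee_sum => l _.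
  (* The top term, [p] times the partial sum of order [r], is left to the induction on [n]; the
     lower ones are bounded through [S <= m]. *)
  rewrite /bconv big_ord_recr/= binn mul1e subnn; apply: leeD.
    apply: lee_sum => u _; apply: lee_wpmul2l => //.
    by apply: lee_wpmul2l; [exact: q0|exact: S_le].
  rewrite (step_moment_zero mrp) PE EFinM; apply: lee_wpmul2l.
    by rewrite lee_fin trans_prob_ge0.
  exact: IHn.
move=> i; apply: (@le_lt_trans _ _ (y i)%:E); last exact: ltry.
rewrite -(cvg_lim (@ereal_hausdorff R) (@S_cvg r i)).
by apply: lime_le; [apply/cvg_ex; exists (m r i)|exact: nearW].
Qed.

Let N := sojourn_moment_mx Q.
Let M r := passage_moment_col Pr X T r j.

Lemma hadamard_sojournE r i l : q r i l < +oo ->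
  (hadamard P (N r) i l)%:E = q r i l.
Proof.
move=> qr; rewrite !mxE -fineZl (sojourn_momentE mrp) fineK//.
by rewrite ge0_fin_numE.
Qed.

(** The scalar recursion with its term of index [r], which is [A] times [M r], moved to the left;
    finiteness allows the passage to real matrices. *)
Lemma passage_moment_system r : (0 < r)%N -> (forall i l, q r i l < +oo) ->
  passage_mx P j *m M r = (hadamard P (N r) *m ones k 1 +
    \sum_(1 <= u < r) ('C(r, u))%:R *:
      (hadamard P (N (r - u)%N) *m hadamard (col j (ones k k - 1%:M)) (M u)))%R.
Proof.
move=> r0 qr.
have qu u i l : (u <= r)%N -> q u i l < +oo by move=> /step_moment_le; apply.
have mfin u i : (u <= r)%N -> m u i \is a fin_num.
  by move=> ur; rewrite ge0_fin_numE// passage_moment_lty// => a b; exact: qu.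
have ME u i : (u <= r)%N -> (M u i 0)%:E = m u i.
  by move=> ur; rewrite mxE fineK// mfin.
apply/colP => i; rewrite passage_mx_mulE [RHS]mxE.
apply/eqP; rewrite subr_eq; apply/eqP; apply: EFin_inj.
rewrite ME// passage_moment_rec !EFinD -[RHS]addeA; congr (_ + _).
  rewrite mxE -sumEFin; apply: eq_bigr => l _.
  by rewrite [ones _ _ _ _]mxE mulr1 hadamard_sojournE.
rewrite big_nat_recr//=; congr (_ + _).
  rewrite summxE -sumEFin big_nat_cond [RHS]big_nat_cond.
  apply: eq_bigr => u; rewrite andbT => /andP[u1 ur].
  rewrite mxE EFinM; congr (_ * _).
  rewrite mxE -sumEFin [LHS]big_mkcond; apply: eq_bigr => l _.
  rewrite EFinM hadamard_sojournE; last by rewrite qu// leq_subr.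
  rewrite [hadamard (col _ _) _ _ _]mxE EFinM ME; last exact: ltnW.
  (* Column [j] of [E - I] removes the summand [l = j]. *)
  rewrite !mxE; case: eqVneq => lj /=.
    by rewrite subrr mul0e mule0.
  by rewrite subr0 mul1e.
rewrite binn mul1e subnn -sumEFin; apply: eq_bigr => l _.
by rewrite EFinM ME// PE /q (step_moment_zero mrp).
Qed.

End passage_moments.

Theorem theorem4p2 (d : measure_display) (Omega : measurableType d)
    (R : realType) (k : nat) (Pr : 'I_k -> probability Omega R)
    (X : nat -> Omega -> 'I_k) (T : nat -> Omega -> R)
    (Q : 'I_k -> 'I_k -> R -> R) (j : 'I_k) :
  let p := trans_prob Q in
  let n := sojourn_moment Q in
  let m := passage_moment Pr X T in
  let P := trans_mx Q in
  let N := sojourn_moment_mx Q in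
  let M r := passage_moment_col Pr X T r j in
  let e := ones k 1 : 'cV[R]_k in
  markov_renewal_process Pr X T Q ->
  (forall i l, 0 < p i l -> (0 < n 1%N i l < +oo)%E) ->
  regular Pr T ->
  universally_accessible Pr X T j ->
  [/\ passage_mx P j \in unitmx,
      [/\ forall i, m 1%N i j \is a fin_num,
          M 1%N = invmx (passage_mx P j) *m (hadamard P (N 1%N) *m e) &
          forall i, m 1%N i j =
            (\sum_(l < k) (p i l)%:E *
               ((1 - (l == j)%:R)%:E * m 1%N l j + n 1%N i l))%E],
      forall r, (1 < r)%N ->
        (forall i l, 0 < p i l -> (n r i l < +oo)%E) ->
        (forall i, m r i j \is a fin_num) /\
        M r = invmx (passage_mx P j) *m
          (hadamard P (N r) *m e +
           \sum_(1 <= s < r) ('C(r, s))%:R *: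
             (hadamard P (N (r - s)%N) *m
                hadamard (col j (ones k k - 1%:M)) (M s))) &
      forall r, (1 < r)%N -> forall i, m r i j =
        (\sum_(l < k) (p i l)%:E * n r i l +
         \sum_(1 <= s < r.+1) ('C(r, s))%:R%:E *
           (\sum_(l < k | l != j) (p i l)%:E * n (r - s)%N i l * m s l j))%E].
Proof.
move=> p n m P N M e mrp n1 regT acc.
have qE r i l : ((p i l)%:E * n r i l = step_moment Pr X T r i l)%E.
  exact: (sojourn_momentE mrp).
have p0 i l : 0 <= p i l by exact: (trans_prob_ge0 mrp).
have n0 r i l : (0 <= n r i l)%E.
  apply: integral_ge0 => t; rewrite /= in_itv/= andbT => t0.
  by rewrite lee_fin exprn_ge0.
have m0 r i : (0 <= m r i j)%E.
  apply: integral_ge0 => t; rewrite /= in_itv/= andbT => t0.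
  by rewrite lee_fin exprn_ge0.
have q_lty r : (forall i l, 0 < p i l -> (n r i l < +oo)%E) ->
    forall i l, (step_moment Pr X T r i l < +oo)%E.
  (* Where [p i l = 0] the product is 0 by [0 * +oo = 0]. *)
  move=> nr i l; rewrite -qE; have := p0 i l; rewrite le_eqVlt => /orP[/eqP <-|pil].
    by rewrite mul0e ltry.
  by rewrite lte_mul_pinfty ?lee_fin// nr.
have U : passage_mx P j \in unitmx by exact: (trans_mx_passage_unit mrp regT acc).
have sol r : (0 < r)%N -> (forall i l, 0 < p i l -> (n r i l < +oo)%E) ->
    (forall i, m r i j \is a fin_num) /\
    M r = invmx (passage_mx P j) *m
      (hadamard P (N r) *m e +
       \sum_(1 <= s < r) ('C(r, s))%:R *:
         (hadamard P (N (r - s)%N) *m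
            hadamard (col j (ones k k - 1%:M)) (M s))).
  move=> r0 nr; split.
    move=> i; rewrite ge0_fin_numE//.
    exact: (passage_moment_lty mrp regT acc (q_lty r nr)).
  rewrite -(passage_moment_system mrp regT acc r0 (q_lty r nr)).
  by rewrite mulKmx.
have n1oo i l : 0 < p i l -> (n 1%N i l < +oo)%E by move=> /n1/andP[].
split => //.
- have [m1 M1] := sol 1%N isT n1oo; split => //.
    by rewrite M1 big_geq// addr0.
  move=> i; rewrite /m (passage_moment_rec mrp regT acc) big_nat1 bin1 mul1e.
  rewrite [X in (_ + X)%E]big_mkcond/= -big_split/=; apply: eq_bigr => l _.
  (* In the extended reals the product distributes over this sum because both summands are
     nonnegative. *)
  have c0 : (0 <= (1 - (l == j)%:R : R)%:E)%E.
    by rewrite lee_fin; case: (l == j); rewrite ?subrr// subr0.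
  rewrite [RHS](ge0_muleDr (p i l)%:E (mule_ge0 c0 (m0 1%N l)) (n0 1%N i l)).
  rewrite qE addeC; congr (_ + _)%E.
  case: eqVneq => /= [_|_]; first by rewrite subrr mul0e mule0.
  by rewrite subr0 mul1e subnn (step_moment_zero mrp).
- by move=> r r1; exact: sol (ltnW r1).
- move=> r r1 i; rewrite /m (passage_moment_rec mrp regT acc).
  congr (_ + _)%E; first by apply: eq_bigr => l _; rewrite qE.
  apply: eq_bigr => s _; congr (_ * _)%E; apply: eq_bigr => l _.
  by rewrite qE.
Qed.
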